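(* For $n \ge 0$ let $H_n$ denote the number of $n \times n$ matrices with entries in $\{0,1\}$ in which every row sum and every column sum equals $2$ (so $H_0=1$, $H_1=0$, $H_2=1$, $H_3=6$). Then the sequence $\left(\sqrt[n]{H_{n}}/n!\right)_{n \ge 1}$ and the sequence $\left(\sqrt[n+1]{H_{n+1}}/(\sqrt[n]{H_n}\, n!)\right)_{n \ge 2}$ both satisfy the Laguerre inequality of order two.
   Context: A sequence $(c_n)_{n \ge m}$ of real numbers satisfies the Laguerre inequality of order two if for all $n \ge m$, $$L_2(c_n) := \frac{1}{2}\sum_{k=0}^{4}(-1)^{k}\binom{4}{k}c_{n+k}c_{n+4-k} = c_nc_{n+4} - 4c_{n+1}c_{n+3} + 3c_{n+2}^2 \ge 0.$$ *)

(* Defs.v *)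
(* Real numbers are the elements of an arbitrary [R : realType]. *)
From HB Require Import structures.
From mathcomp Require Import all_boot all_order all_algebra.
From mathcomp Require Import reals exp.
From mathcomp Require Import ring.

Set Implicit Arguments.
Unset Strict Implicit.
Unset Printing Implicit Defensive.

Import Order.TTheory GRing.Theory Num.Theory.
Local Open Scope ring_scope.

Definition two_regular_mx (n : nat) : {set 'M[bool]_n} :=
  [set A : 'M[bool]_n |
    [forall i, (\sum_j (A i j : nat))%N == 2%N]
    && [forall j, (\sum_i (A i j : nat))%N == 2%N]].

Definition H (n : nat) : nat := #|two_regular_mx n|.

(* Meant for 0 < n and 0 <= x, where [nthrootP] and [nthroot_ge0]
   characterize it; in particular the root of 0 is 0. *)
Definition nthroot (R : realType) (n : nat) (x : R) : R := x `^ (n%:R^-1).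

Lemma nthroot_ge0 (R : realType) (n : nat) (x : R) : 0 <= nthroot n x.
Proof. exact: powR_ge0. Qed.

Lemma nthrootP (R : realType) (n : nat) (x : R) :
  (0 < n)%N -> 0 <= x -> nthroot n x ^+ n = x.
Proof.
move=> n0 x0; rewrite /nthroot -powR_mulrn ?powR_ge0// -powRrM mulVf ?powRr1//.
by rewrite pnatr_eq0 -lt0n.
Qed.

Definition L2 (R : realType) (c : nat -> R) (n : nat) : R :=
  2^-1 * \sum_(k < 5) (-1) ^+ k * 'C(4, k)%:R * c (n + k)%N * c (n + 4 - k)%N.

Lemma L2E (R : realType) (c : nat -> R) (n : nat) :
  L2 c n = c n * c (n + 4)%N - 4 * c (n + 1)%N * c (n + 3)%N
           + 3 * c (n + 2)%N ^+ 2.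
Proof.
pose t k m := (-1) ^+ k * m%:R * c (n + k)%N * c (n + 4 - k)%N.
have -> : L2 c n = 2^-1 * (t 0%N 1%N + (t 1%N 4%N + (t 2%N 6%N + (t 3%N 4%N + (t 4%N 1%N + 0)))))%R.
  by rewrite /L2 !big_ord_recl big_ord0.
rewrite /t addn0 subn0 addnK -!addnBA //.
rewrite (erefl : (4 - 1 = 3)%N) (erefl : (4 - 2 = 2)%N) (erefl : (4 - 3 = 1)%N).
by field.
Qed.

(* The sequence is (c_n)_{n >= m}: the values of [c] below m are irrelevant. *)
Definition laguerre_order2 (R : realType) (m : nat) (c : nat -> R) : Prop :=
  forall n : nat, (m <= n)%N -> 0 <= L2 c n.

(* Main.v *)
From Stdlib Require Import NArith.
Require Import Defs.
From mathcomp Require Import all_boot all_order all_algebra.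
From mathcomp Require Import reals exp.
From mathcomp Require Import sequences.
From mathcomp Require Import ring lra zify.

(* With a_n = H_n^(1/n), dividing the Laguerre inequality by (a_(n+2) / (n+2)!)^2
   turns it into
     4 (n+2) (n+4) r1 <= (n+1) (n+2) r2 + 3 (n+3) (n+4),
   where ln r1 and ln r2 are combinations of second differences s_n of ln a_n.
   The two sides differ by about 6 to leading order as soon as s_n is close to
   -2 / n^2, and the same holds with a_(n+1) / a_n in place of a_n.
   To estimate s_n, write q_n = H_(n+1) / H_n; then n (n+1) (n+2) s_n telescopes:
   its increments are (n+1) (n+2) times the second differences of ln q_n. The
   recurrence H_(n+2) = C(n+2, 2) (2 H_(n+1) + (n+1) H_n) pins q_n down to within
   1/20 of n^2 + 3n/2 + 3/4, which suffices for n >= 7; the cases n <= 6 follow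
   from three-digit decimal bounds of the roots.
   The recurrence comes from deleting a row: its two ones leave two columns of
   sum 1, which are then merged into one column of sum 2. *)

(** * Row-by-row counts and the merging of two columns *)

Set Implicit Arguments.
Unset Strict Implicit.
Unset Printing Implicit Defensive.

(* Number of 0/1 matrices with k rows of sum 2, and with a columns of sum 2, b
   columns of sum 1 and all other columns zero; the recursion removes a row. *)
Fixpoint margin_count (k a b : nat) : nat :=
  if k is k'.+1 then
    'C(a, 2) * margin_count k' (a - 2) (b + 2)
    + a * b * margin_count k' (a - 1) b
    + 'C(b, 2) * margin_count k' a (b - 2)
  else (a == 0) && (b == 0).

Lemma margin_countS k a b : margin_count k.+1 a b =
  'C(a, 2) * margin_count k (a - 2) (b + 2)
  + a * b * margin_count k (a - 1) b
  + 'C(b, 2) * margin_count k a (b - 2).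
Proof. by []. Qed.

(* Merging two columns of sum 1 gives a column of sum 2, with two preimages,
   unless both ones lie in the same one of the k rows. *)
Lemma margin_count_merge k a b :
  margin_count k a b.+2
  = 2 * margin_count k a.+1 b + k * margin_count k.-1 a b.
Proof.
elim: k a b => [|k IH] a b.
  by rewrite /= !andbF.
(* [E1] to [E3] apply the induction hypothesis to the three terms of the row recursion, [E4] unfolds
   one more row. Where a truncated subtraction would falsify the index, the coefficient in front is
   0. *)
have E1 : 'C(a, 2) * margin_count k (a - 2) (b + 4) = 'C(a, 2) *
    (2 * margin_count k (a - 1) (b + 2) + k * margin_count k.-1 (a - 2) (b + 2)).
  case: a => [|[|a]] //; congr (_ * _).
  by rewrite addn4 IH addn2 !subn2 subn1.
have E2 : a * margin_count k (a - 1) (b + 2) =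
    a * (2 * margin_count k a b + k * margin_count k.-1 (a - 1) b).
  by rewrite addn2; case: a {E1} => [|a] //; rewrite subn1 IH.
have E3 : 'C(b, 2) * margin_count k a b = 'C(b, 2) *
    (2 * margin_count k a.+1 (b - 2) + k * margin_count k.-1 a (b - 2)).
  case: b {E1 E2} => [|[|b]] //; congr (_ * _).
  by rewrite IH !subn2.
have E4 : k * margin_count k a b = k * (
    'C(a, 2) * margin_count k.-1 (a - 2) (b + 2)
    + a * b * margin_count k.-1 (a - 1) b
    + 'C(b, 2) * margin_count k.-1 a (b - 2)).
  by case: k {IH E1 E2 E3}.
rewrite [LHS]margin_countS (margin_countS k a.+1) (_ : k.+1.-1 = k) //.
rewrite [k.+1 * _]mulSn E4 !subSS !subn0 (_ : b.+2 + 2 = b + 4);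
  last by rewrite addn2 addn4.
rewrite -(addn2 b) E1 (mulnDr a) (mulnDl (a * b)) -mulnA (mulnCA a b) E2 (mulSn a b).
rewrite addn2 !binS !bin0 !bin1 !mulnDl E3.
ring.
Qed.

(** * Matrices with prescribed column sums, and the recurrence for [H] *)

Section Margins.
Variable T : finType.
Implicit Types X Y S P Q : {set T}.

(** A subset of a disjoint union is the union of its traces on the two parts, and these traces are
    chosen independently. *)
Lemma card_draws_setU X Y i j : [disjoint X & Y] ->
  #|[set S : {set T} | [&& S \subset X :|: Y, #|S :&: X| == i & #|S :&: Y| == j]]|
  = 'C(#|X|, i) * 'C(#|Y|, j).
Proof.
move=> dXY.
have XY0 : X :&: Y = set0 by apply/eqP; rewrite setI_eq0.
have cap P Q : P \subset X -> Q \subset Y ->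
    ((P :|: Q) :&: X = P) * ((P :|: Q) :&: Y = Q).
  move=> /setIidPl PX /setIidPl QY; rewrite !setIUl PX QY.
  have -> : Q :&: X = set0 by rewrite -QY -setIA (setIC Y) XY0 setI0.
  have -> : P :&: Y = set0 by rewrite -PX -setIA XY0 setI0.
  by rewrite setU0 set0U.
rewrite -!cards_draws -cardsX.
rewrite -(card_in_imset (f := fun u : {set T} * {set T} => u.1 :|: u.2)); last first.
  move=> [P Q] [P' Q'] /=; rewrite !inE /= => /andP[/andP[PX _] /andP[QY _]].
  move=> /andP[/andP[PX' _] /andP[QY' _]] e.
  move: (cap _ _ PX QY) (cap _ _ PX' QY').
  by rewrite e => -[-> ->] [-> ->].
congr #|pred_of_set _|; apply/setP => S; rewrite !inE; apply/and3P/imsetP.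
  move=> [SXY iX jY]; exists (S :&: X, S :&: Y).
    by rewrite !inE /= !subsetIr iX jY.
  by rewrite /= -setIUr; apply/esym/setIidPl.
move=> [[P Q]]; rewrite !inE /= => /andP[/andP[PX iP] /andP[QY jQ]] ->.
by rewrite !cap // iP jQ setUSS.
Qed.

(** Here S is the support of a row. The split by |S ∩ X| = 2, 1, 0 yields the three terms of the
    recursion of [margin_count]. *)
Lemma sum_draws_pair (f : nat -> nat -> nat) X Y : [disjoint X & Y] ->
  \sum_(S : {set T} | (S \subset X :|: Y) && (#|S| == 2)) f #|S :&: X| #|S :&: Y|
  = 'C(#|X|, 2) * f 2 0 + #|X| * #|Y| * f 1 1 + 'C(#|Y|, 2) * f 0 2.
Proof.
move=> dXY.
have cS S : S \subset X :|: Y -> #|S| = #|S :&: X| + #|S :&: Y|.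
  move=> /setIidPl SXY; rewrite -{1}SXY setIUr cardsU setIACA setIid.
  by move: dXY; rewrite -setI_eq0 => /eqP ->; rewrite setI0 cards0 subn0.
pose D i j := [set S : {set T} |
  [&& S \subset X :|: Y, #|S :&: X| == i & #|S :&: Y| == j]].
have sD i j : \sum_(S in D i j) f #|S :&: X| #|S :&: Y| =
    'C(#|X|, i) * 'C(#|Y|, j) * f i j.
  rewrite -card_draws_setU // -sum_nat_const; apply: eq_bigr => S.
  by rewrite inE => /and3P[_ /eqP-> /eqP->].
rewrite (bigID (fun S => #|S :&: X| == 2)) -addnA /=; congr addn.
  transitivity ('C(#|X|, 2) * 'C(#|Y|, 0) * f 2 0); last by rewrite bin0 muln1.
  rewrite -sD.
  apply: eq_bigl => S; rewrite !inE; case SXY: (S \subset _) => //=.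
  by rewrite (cS S SXY); case: #|S :&: X| => [|[|[|n]]]; rewrite ?andbT ?andbF.
rewrite (bigID (fun S => #|S :&: X| == 1)) /=; congr addn.
  rewrite -(bin1 #|X|) -(bin1 #|Y|) -sD.
  apply: eq_bigl => S; rewrite !inE; case SXY: (S \subset _) => //=.
  by rewrite (cS S SXY); case: #|S :&: X| => [|[|[|n]]]; rewrite ?andbT ?andbF.
transitivity ('C(#|X|, 0) * 'C(#|Y|, 2) * f 0 2); last by rewrite bin0 mul1n.
rewrite -sD.
apply: eq_bigl => S; rewrite !inE; case SXY: (S \subset _) => //=.
by rewrite (cS S SXY); case: #|S :&: X| => [|[|[|n]]]; rewrite ?andbT ?andbF.
Qed.

End Margins.

Definition margin_mx n m (X Y : {set 'I_m}) : {set 'M[bool]_(n, m)} :=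
  [set A : 'M[bool]_(n, m) | [forall i, \sum_j (A i j : nat) == 2]
    && [forall j, \sum_i (A i j : nat) == 2 * (j \in X) + (j \in Y)]].

Lemma card_margin_mx n m (X Y : {set 'I_m}) : [disjoint X & Y] ->
  #|margin_mx n X Y| = margin_count n #|X| #|Y|.
Proof.
elim: n X Y => [|n IH] X Y dXY /=.
  rewrite !cards_eq0; have [->|/set0Pn[j jX]] := eqVneq X set0; last first.
    apply: eq_card0 => A; rewrite !inE; apply/negP => /andP[_ /forallP/(_ j)].
    by rewrite big_ord0 jX.
  have [->|/set0Pn[j jY]] := eqVneq Y set0; last first.
    apply: eq_card0 => A; rewrite !inE; apply/negP => /andP[_ /forallP/(_ j)].
    by rewrite big_ord0 jY addn1.
  apply/eqP/cards1P; exists (const_mx true); apply/setP => A.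
  have -> : A = const_mx true by apply/matrixP => -[].
  rewrite !inE eqxx; apply/andP; split; apply/forallP; first by case.
  by move=> j; rewrite big_ord0 !inE.
pose row0 (A : 'M[bool]_(n.+1, m)) := [set j | A ord0 j].
pose stack (S : {set 'I_m}) (B : 'M[bool]_(n, m)) : 'M[bool]_(n.+1, m) :=
  (\matrix_(i, j) if unlift ord0 i is Some i' then B i' j else j \in S)%R.
have stack0 S B j : stack S B ord0 j = (j \in S) by rewrite mxE unlift_none.
have stackS S B i j : stack S B (lift ord0 i) j = B i j by rewrite mxE liftK.
have stack_inj S : injective (stack S).
  by move=> B C e; apply/matrixP => i j; rewrite -(stackS S) e stackS.
have cardE (S : {set 'I_m}) : \sum_j ((j \in S) : nat) = #|S|.
  by rewrite -sum1_card [RHS]big_mkcond; apply: eq_bigr => j _; case: (_ \in _).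
(* Once the first row has support S, the columns in X ∩ S still need sum 1 and those in Y ∩ S need
   sum 0. A column outside X ∪ Y cannot be hit. *)
have fiber S : #|[set A in margin_mx n.+1 X Y | row0 A == S]| =
    if (S \subset X :|: Y) && (#|S| == 2)
    then margin_count n (#|X| - #|S :&: X|) (#|Y| - #|S :&: Y| + #|S :&: X|) else 0.
  have colE B j : \sum_i (stack S B i j : nat) = (j \in S) + \sum_i (B i j : nat).
    by rewrite big_ord_recl stack0; congr addn; apply: eq_bigr => i _; rewrite stackS.
  have rowE A : row0 A = S -> stack S (\matrix_(i, j) A (lift ord0 i) j)%R = A.
    move=> <-; apply/matrixP => i j; rewrite mxE; case: unliftP => [k|] ->.
      by rewrite mxE.
    by rewrite inE.
  case: ifPn => [/andP[SXY S2]|SN]; last first.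
    apply: eq_card0 => A; rewrite !inE.
    apply/negP => /andP[/andP[/forallP r /forallP c] /eqP rS].
    case/negP: SN; rewrite -cardE; apply/andP; split.
      apply/subsetP => j jS; move: (c j); rewrite -(rowE A rS) colE jS inE.
      by case: (j \in X) => //; case: (j \in Y).
    by move: (r ord0); rewrite -{1}(rowE A rS); under eq_bigr do rewrite stack0.
  have dXY' : [disjoint X :\: S & (Y :\: S) :|: (S :&: X)].
    apply/pred0P => j; rewrite /= !inE.
    by have /pred0P/(_ j) := dXY; rewrite /=; do !case: (_ \in _).
  have -> : margin_count n (#|X| - #|S :&: X|) (#|Y| - #|S :&: Y| + #|S :&: X|) =
      margin_count n #|X :\: S| #|(Y :\: S) :|: (S :&: X)|.
    rewrite cardsU !cardsD (setIC X) (setIC Y); congr margin_count.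
    rewrite (_ : (Y :\: S) :&: (S :&: X) = set0) ?cards0 ?subn0 //.
    by apply/setP => j; rewrite !inE; do !case: (_ \in _).
  rewrite -IH // -(card_imset _ (@stack_inj S)); congr #|pred_of_set _|.
  have key B : (stack S B \in margin_mx n.+1 X Y) =
      (B \in margin_mx n (X :\: S) ((Y :\: S) :|: (S :&: X))).
    rewrite !inE; congr andb; apply/forallP/forallP.
    - by move=> r i; move: (r (lift ord0 i)); under eq_bigr do rewrite stackS.
    - move=> r i; case: (unliftP ord0 i) => [k|] ->.
        by under eq_bigr do rewrite stackS.
      by under eq_bigr do rewrite stack0; rewrite cardE.
    - move=> c j; move: (c j); rewrite colE !inE.
      have /pred0P/(_ j) := dXY; have /subsetP/(_ j) := SXY; rewrite inE /=.
      by do !case: (_ \in _); move=> // h; try by have := h isT.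
    - move=> c j; move: (c j); rewrite colE !inE.
      have /pred0P/(_ j) := dXY; have /subsetP/(_ j) := SXY; rewrite inE /=.
      by do !case: (_ \in _); move=> // h; try by have := h isT.
  apply/setP => A; rewrite inE; apply/andP/imsetP => [[Am /eqP rS]|[B Bm ->]].
    by exists (\matrix_(i, j) A (lift ord0 i) j)%R; rewrite -?key rowE.
  rewrite key Bm; split=> //; apply/eqP/setP => j.
  by rewrite inE stack0.
rewrite -sum1_card (partition_big row0 predT) //=.
transitivity (\sum_(S : {set 'I_m}) if (S \subset X :|: Y) && (#|S| == 2)
    then margin_count n (#|X| - #|S :&: X|) (#|Y| - #|S :&: Y| + #|S :&: X|) else 0).
  apply: eq_bigr => S _; rewrite -fiber -sum1_card.
  by apply: eq_bigl => A; rewrite !inE.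
rewrite -big_mkcond /=.
rewrite (@sum_draws_pair _ (fun i j => margin_count n (#|X| - i) (#|Y| - j + i))) //.
(* The middle term has [#|Y| - 1 + 1], which differs from [#|Y|] only for empty Y, where its
   coefficient is 0. *)
rewrite !subn0 addn0; case: #|Y| => [|b]; first by rewrite !muln0.
by rewrite subnK.
Qed.

Lemma H_margin_count n : H n = margin_count n n 0.
Proof.
rewrite -[X in margin_count _ X](card_ord n) -(cards0 'I_n) -cardsT.
rewrite -card_margin_mx; last by rewrite -setI_eq0 setI0.
congr #|pred_of_set _|; apply/setP => A; rewrite !inE; congr andb.
by apply: eq_forallb => j; rewrite !inE.
Qed.

(** With no column of sum 1, only the first term of the row recursion survives; merging its two
    columns of sum 1 leads back to [H]. *)
Lemma H_recurrence n : H n.+2 = 'C(n.+2, 2) * (2 * H n.+1 + n.+1 * H n).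
Proof.
rewrite !H_margin_count margin_countS muln0 mul0n addn0 addn0 subn2.
by rewrite add0n margin_count_merge.
Qed.

Lemma H0 : H 0 = 1. Proof. by rewrite H_margin_count. Qed.
Lemma H1 : H 1 = 0. Proof. by rewrite H_margin_count. Qed.

Import Order.TTheory GRing.Theory Num.Theory.
Import Defs.
Local Open Scope ring_scope.

Lemma H_gt0 n : (0 < H n.+2)%N.
Proof.
elim: n => [|n IH]; rewrite H_recurrence ?H0 ?H1 //.
by rewrite muln_gt0 bin_gt0 addn_gt0 muln_gt0 IH.
Qed.

(** * Numerical checks in binary arithmetic *)

Section Binary.
Variable R : realType.

(** Carries inequalities between large integers, decided by computation in [N], over to the
    reals. *)
Definition natN (x : N) : R := (N.to_nat x)%:R.

Lemma natND x y : natN (x + y)%num = natN x + natN y.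
Proof. by rewrite /natN N2Nat.inj_add -natrD. Qed.

Lemma natNM x y : natN (x * y)%num = natN x * natN y.
Proof. by rewrite /natN N2Nat.inj_mul -natrM. Qed.

Lemma natN_of n : natN (N.of_nat n) = n%:R.
Proof. by rewrite /natN Nat2N.id. Qed.

Lemma natNX x n : natN (iter n (N.mul x) 1%num) = natN x ^+ n.
Proof. by elim: n => [|n IH]; rewrite ?expr0 // iterS natNM IH exprS. Qed.

Lemma natN_le x y : (x <=? y)%num -> natN x <= natN y.
Proof. by move=> /N.leb_le h; rewrite ler_nat; apply/ssrnat.leP; lia. Qed.

Lemma natN_ge0 x : 0 <= natN x.
Proof. exact: ler0n. Qed.

End Binary.

(** Computes (H_n, H_(n+1)) by the recurrence, since the cardinal defining [H] is out of reach of
    evaluation. *)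
Fixpoint H_pair (n : nat) : N * N :=
  if n is m.+1 then
    let: (x, y) := H_pair m in
    (y, N.of_nat 'C(m.+2, 2) * (N.of_nat 2 * y + N.of_nat m.+1 * x))%num
  else (1, 0)%num.

Definition HN n := (H_pair n).1.

Lemma HNE (R : realType) n : natN R (HN n) = (H n)%:R.
Proof.
suff e : H_pair n = (N.of_nat (H n), N.of_nat (H n.+1)) by rewrite /HN e natN_of.
elim: n => [|n IH]; first by rewrite H0 H1.
rewrite [H_pair _.+1]/H_pair -/H_pair IH H_recurrence.
by rewrite -!Nat2N.inj_mul -Nat2N.inj_add -Nat2N.inj_mul.
Qed.

(* root_lo n and root_up n are lower and upper bounds of 1000 H_n^(1/n) for
   0 < n < 12, with 0 as the exact value at n = 1; junk elsewhere. *)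
Definition root_lo (n : nat) : N :=
  nth 0%num [:: 0; 0; 1000; 1817; 3080; 4591; 6388; 8463; 10817; 13449; 16357;
    19542]%num n.
Definition root_up (n : nat) : N := if n == 1%N then 0%num else (root_lo n + 1)%num.

(** The bounds are compared after taking n-th powers, so only integers occur: [iter n (N.mul x) 1]
    is x^n. *)
Lemma root_check : all (fun n =>
  (iter n (N.mul (root_lo n)) 1 <=? iter n (N.mul (N.of_nat 1000)) 1 * HN n)%num &&
  (iter n (N.mul (N.of_nat 1000)) 1 * HN n <=? iter n (N.mul (root_up n)) 1)%num)
  (iota 1 11).
Proof. by vm_compute. Qed.

(** Upper bounds of the roots stand on the smaller side and lower bounds on the larger, so the
    inequality for the true roots follows. *)
Lemma laguerre_check1 : all (fun n =>
  N.of_nat (4 * (n + 2) * (n + 4)) * (root_up (n + 1) * root_up (n + 3)) <=?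
  N.of_nat ((n + 1) * (n + 2)) * (root_lo n * root_lo (n + 4)) +
  N.of_nat (3 * (n + 3) * (n + 4)) * (root_lo (n + 2) * root_lo (n + 2)))%num
  (iota 1 6).
Proof. by vm_compute. Qed.

(* With b_k = 1000 H_k^(1/k), the inequality for the quotients b_(k+1) / b_k has been
   multiplied by b_n b_(n+1) b_(n+2)^2 b_(n+3) b_(n+4). *)
Lemma laguerre_check2 : all (fun n =>
  N.of_nat (4 * (n + 2) * (n + 4)) *
    (root_up (n + 2) * root_up (n + 4) *
      (root_up n * root_up (n + 4) * (root_up (n + 2) * root_up (n + 2)))) <=?
  N.of_nat ((n + 1) * (n + 2)) *
    (root_lo (n + 1) * root_lo (n + 5) *
      (root_lo (n + 1) * root_lo (n + 3) * (root_lo (n + 2) * root_lo (n + 2)))) +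
  N.of_nat (3 * (n + 3) * (n + 4)) *
    (root_lo (n + 3) * root_lo (n + 3) *
      (root_lo (n + 1) * root_lo (n + 3) * (root_lo n * root_lo (n + 4)))))%num
  (iota 2 5).
Proof. by vm_compute. Qed.

(* The bounds 183/4 = 6^2 + 3/2 * 6 + 3/4 and 229/5 = 183/4 + 1/20 of H_7 / H_6. *)
Lemma ratio_check : ((N.of_nat 183 * HN 6 <=? N.of_nat 4 * HN 7) &&
  (N.of_nat 5 * HN 7 <=? N.of_nat 229 * HN 6))%num.
Proof. by vm_compute. Qed.

(** Places the quotient a_7 a_9 / a_8^2 of roots between 720/742 and 281/288, to start the induction
    on second differences at n = 7. *)
Lemma base_check : (
  (N.of_nat 288 * (root_up 7 * root_up 9) <=?
   N.of_nat 281 * (root_lo 8 * root_lo 8)) &&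
  (N.of_nat 720 * (root_up 8 * root_up 8) <=?
   N.of_nat 742 * (root_lo 7 * root_lo 9)))%num.
Proof. by vm_compute. Qed.

(** * Reduction of the Laguerre inequality to logarithms *)

Section Real.
Variable R : realType.
Implicit Types (b c : nat -> R) (n : nat) (x : R).

(** The hypothesis is the claim multiplied by (n+2)! (n+4)!. *)
Lemma L2_div_fact_ge0 b c n : (forall k, c k = b k / k`!%:R) ->
  (4 * (n + 2) * (n + 4))%:R * (b (n + 1)%N * b (n + 3)%N) <=
  ((n + 1) * (n + 2))%:R * (b n * b (n + 4)%N) +
    (3 * (n + 3) * (n + 4))%:R * (b (n + 2)%N * b (n + 2)%N) ->
  0 <= L2 c n.
Proof.
move=> cE h; rewrite L2E !cE.
have f0 : n`!%:R != 0 :> R by rewrite pnatr_eq0 -lt0n fact_gt0.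
have fS k : (k.+1)`!%:R = (k%:R + 1) * k`!%:R :> R by rewrite factS natrM -natr1.
rewrite !addnS !addn0 !fS.
have n0 : 0 <= n%:R :> R by exact: ler0n.
rewrite [X in 0 <= X](_ : _ =
  (((n + 1) * (n + 2))%:R * (b n * b (n + 4)%N) +
    (3 * (n + 3) * (n + 4))%:R * (b (n + 2)%N * b (n + 2)%N) -
  (4 * (n + 2) * (n + 4))%:R * (b (n + 1)%N * b (n + 3)%N)) /
   ((n%:R + 1) ^+ 2 * (n%:R + 2) ^+ 2 * (n%:R + 3) * (n%:R + 4) * n`!%:R ^+ 2)).
  by rewrite divr_ge0 ?subr_ge0 // !mulr_ge0 ?sqr_ge0 //; lra.
rewrite !natrM !natrD !addnS !addn0 -!natr1.
by field; rewrite f0 /=; repeat (apply/andP; split); apply: lt0r_neq0; lra.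
Qed.

Lemma ln_le_subr1 x : 0 < x -> ln x <= x - 1.
Proof. by move=> x0; have := expR_ge1Dx (ln x); rewrite lnK // => h; lra. Qed.

Lemma ln_ge_subV x : 0 < x -> 1 - x^-1 <= ln x.
Proof.
move=> x0; have := @ln_le_subr1 x^-1; rewrite invr_gt0 lnV // => /(_ x0) h; lra.
Qed.

(** After division by b_(n+2)^2 the two products become exp u and exp v. The estimates exp u <= 1 /
    (1 - u) and exp v >= 1 + v leave an inequality polynomial in u and v. *)
Lemma L2_div_fact_ge0_ln b c n (u v : R) : (forall k, c k = b k / k`!%:R) ->
  (forall k, (n <= k)%N -> 0 < b k) ->
  u = ln (b (n + 1)%N) + ln (b (n + 3)%N) - 2 * ln (b (n + 2)%N) ->
  v = ln (b n) + ln (b (n + 4)%N) - 2 * ln (b (n + 2)%N) ->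
  u < 1 ->
  4 * (n%:R + 2) * (n%:R + 4) <=
  (1 - u) * ((n%:R + 1) * (n%:R + 2) * (1 + v) + 3 * (n%:R + 3) * (n%:R + 4)) ->
  0 <= L2 c n.
Proof.
move=> cE b0 uE vE u1 h; apply: (L2_div_fact_ge0 cE).
have n0 : 0 <= n%:R :> R by exact: ler0n.
have [l p] : exists l : nat -> R, forall k, b (n + k)%N = expR (l k).
  by exists (fun k => ln (b (n + k)%N)) => k; rewrite lnK // posrE b0 ?leq_addr.
have p0 := p 0%N; rewrite addn0 in p0.
have -> : b (n + 1)%N * b (n + 3)%N = b (n + 2)%N ^+ 2 * expR u.
  by rewrite uE !p !expRK -expRM_natl -!expRD; congr expR; ring.
have -> : b n * b (n + 4)%N = b (n + 2)%N ^+ 2 * expR v.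
  by rewrite vE p0 !p !expRK -expRM_natl -!expRD; congr expR; ring.
have Eu : expR u <= (1 - u)^-1.
  rewrite -[u]opprK expRN opprK lef_pV2 ?posrE ?expR_gt0 //; last lra.
  by have := expR_ge1Dx (- u); lra.
have Ev := expR_ge1Dx v.
have b2 : 0 < b (n + 2)%N by rewrite b0 ?leq_addr.
rewrite !natrM !natrD; set y := b (n + 2)%N in b2 *.
suff g : 4 * (n%:R + 2) * (n%:R + 4) * expR u <=
    (n%:R + 1) * (n%:R + 2) * expR v + 3 * (n%:R + 3) * (n%:R + 4).
  by have := ler_wpM2l (sqr_ge0 y) g; rewrite expr2 => k; lra.
apply: (@le_trans _ _ (4 * (n%:R + 2) * (n%:R + 4) * (1 - u)^-1)).
  by rewrite ler_wpM2l // !mulr_ge0 //; lra.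
rewrite ler_pdivrMr; last lra.
apply: (le_trans h); rewrite [leLHS]mulrC ler_wpM2r //; first lra.
by rewrite lerD2r ler_wpM2l // mulr_ge0 //; lra.
Qed.

(** * The cases n <= 6 *)

Definition rootH n : R := nthroot n (H n)%:R.

Lemma rootH_ge0 n : 0 <= rootH n.
Proof. exact: nthroot_ge0. Qed.

Lemma rootH_gt0 n : (2 <= n)%N -> 0 < rootH n.
Proof. by case: n => [|[|n]] // _; rewrite powR_gt0 // ltr0n H_gt0. Qed.

Lemma root_bounds n : (1 <= n <= 11)%N ->
  natN R (root_lo n) <= 1000 * rootH n <= natN R (root_up n).
Proof.
move=> n1; have /allP/(_ n) := root_check.
rewrite mem_iota => /(_ n1) /andP[/(natN_le R) lo /(natN_le R) up].
have n0 : (0 < n)%N by case/andP: n1.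
have e : natN R (iter n (N.mul (N.of_nat 1000)) 1 * HN n)%num = (1000 * rootH n) ^+ n.
  by rewrite natNM natNX natN_of HNE exprMn nthrootP.
have B0 : 0 <= 1000 * rootH n by rewrite mulr_ge0 // rootH_ge0.
move: lo up; rewrite e !natNX => lo up; apply/andP; split.
  by rewrite -(@ler_pXn2r _ n) // nnegrE natN_ge0.
by rewrite -(@ler_pXn2r _ n) // nnegrE natN_ge0.
Qed.

Lemma laguerre_small1 n : (1 <= n <= 6)%N ->
  0 <= L2 (fun n => rootH n / n`!%:R) n.
Proof.
move=> n1; have /allP/(_ n) := laguerre_check1; rewrite mem_iota => /(_ n1) /(natN_le R).
rewrite natND !natNM !natN_of => h.
have B k : (k <= 4)%N -> [/\ 0 <= 1000 * rootH (n + k),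
    natN R (root_lo (n + k)) <= 1000 * rootH (n + k)
    & 1000 * rootH (n + k) <= natN R (root_up (n + k))].
  move=> kn; have /root_bounds/andP[lo up] : (1 <= n + k <= 11)%N by lia.
  by split=> //; rewrite mulr_ge0 // rootH_ge0.
have [] := B 0%N isT; rewrite addn0.
have [] := B 1%N isT; have [] := B 2%N isT; have [] := B 3%N isT; have [] := B 4%N isT.
move=> p4 l4 u4 p3 l3 u3 p2 l2 u2 p1 l1 u1 p0 l0 u0.
apply: (@L2_div_fact_ge0 rootH) => //.
rewrite -(ler_pM2l (_ : 0 < (1000 * 1000 : R))); last by rewrite mulr_gt0.
have k := natN_ge0 R.
have g1 := ler_pM p1 p3 u1 u3.
have g2 := ler_pM (k _) (k _) l0 l4.
have g3 := ler_pM (k _) (k _) l2 l2.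
have w1 := ler_wpM2l (ler0n R (4 * (n + 2) * (n + 4))) g1.
have w2 := ler_wpM2l (ler0n R ((n + 1) * (n + 2))) g2.
have w3 := ler_wpM2l (ler0n R (3 * (n + 3) * (n + 4))) g3.
have := le_trans w1 (le_trans h (lerD w2 w3)).
congr (_ <= _); ring.
Qed.

Lemma laguerre_small2 n : (2 <= n <= 6)%N ->
  0 <= L2 (fun n => rootH n.+1 / rootH n / n`!%:R) n.
Proof.
move=> n1; have /allP/(_ n) := laguerre_check2; rewrite mem_iota => /(_ n1) /(natN_le R).
rewrite natND !natNM !natN_of => h.
have B k : (k <= 5)%N -> [/\ 0 < 1000 * rootH (n + k),
    natN R (root_lo (n + k)) <= 1000 * rootH (n + k)
    & 1000 * rootH (n + k) <= natN R (root_up (n + k))].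
  move=> kn; have /root_bounds/andP[lo up] : (1 <= n + k <= 11)%N by lia.
  by split=> //; rewrite mulr_gt0 // rootH_gt0; lia.
have [] := B 0%N isT; rewrite addn0.
have [] := B 1%N isT; have [] := B 2%N isT; have [] := B 3%N isT; have [] := B 4%N isT.
have [] := B 5%N isT; clear B.
(* The scale 1000 of the root table cancels in quotients. *)
have bE k : rootH k.+1 / rootH k = 1000 * rootH k.+1 / (1000 * rootH k).
  by rewrite -mulf_div divff ?mul1r // pnatr_eq0.
move=> p5 l5 u5 p4 l4 u4 p3 l3 u3 p2 l2 u2 p1 l1 u1 p0 l0 u0.
apply: (@L2_div_fact_ge0 (fun k => rootH k.+1 / rootH k)) => //.
rewrite !bE -!addnS -(addn1 n) {bE}.
move: p5 l5 u5 p4 l4 u4 p3 l3 u3 p2 l2 u2 p1 l1 u1 p0 l0 u0.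
move: (1000 * rootH n) (1000 * rootH (n + 1)) (1000 * rootH (n + 2))
  (1000 * rootH (n + 3)) (1000 * rootH (n + 4)) (1000 * rootH (n + 5)) => b0 b1 b2 b3 b4 b5.
move=> p5 l5 u5 p4 l4 u4 p3 l3 u3 p2 l2 u2 p1 l1 u1 p0 l0 u0.
have M : 0 < b0 * b4 * (b2 * b2) * (b1 * b3) by rewrite !mulr_gt0.
rewrite -(ler_pM2r M).
have k := natN_ge0 R; have kM (x y : N) : 0 <= natN R x * natN R y by rewrite mulr_ge0.
have pM (x y : R) : 0 < x -> 0 < y -> 0 <= x * y by move=> x0 y0; rewrite mulr_ge0 // ltW.
have up (x y x' y' : R) : 0 < x -> 0 < y -> x <= x' -> y <= y' -> x * y <= x' * y'.
  by move=> x0 y0; apply: ler_pM; exact: ltW.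
have g1 := ler_pM (pM _ _ p2 p4) (mulr_ge0 (pM _ _ p0 p4) (pM _ _ p2 p2))
  (up _ _ _ _ p2 p4 u2 u4) (ler_pM (pM _ _ p0 p4) (pM _ _ p2 p2)
    (up _ _ _ _ p0 p4 u0 u4) (up _ _ _ _ p2 p2 u2 u2)).
have g2 := ler_pM (kM _ _) (mulr_ge0 (kM _ _) (kM _ _)) (ler_pM (k _) (k _) l1 l5)
  (ler_pM (kM _ _) (kM _ _) (ler_pM (k _) (k _) l1 l3) (ler_pM (k _) (k _) l2 l2)).
have g3 := ler_pM (kM _ _) (mulr_ge0 (kM _ _) (kM _ _)) (ler_pM (k _) (k _) l3 l3)
  (ler_pM (kM _ _) (kM _ _) (ler_pM (k _) (k _) l1 l3) (ler_pM (k _) (k _) l0 l4)).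
have w1 := ler_wpM2l (ler0n R (4 * (n + 2) * (n + 4))) g1.
have w2 := ler_wpM2l (ler0n R ((n + 1) * (n + 2))) g2.
have w3 := ler_wpM2l (ler0n R (3 * (n + 3) * (n + 4))) g3.
have := le_trans w1 (le_trans h (lerD w2 w3)).
have e0 := lt0r_neq0 p0; have e1 := lt0r_neq0 p1; have e2 := lt0r_neq0 p2.
have e3 := lt0r_neq0 p3; have e4 := lt0r_neq0 p4.
congr (_ <= _); field; rewrite ?e0 ?e1 ?e2 ?e3 ?e4 //.
Qed.

(** * Second differences of the logarithms *)

Definition lnroot_diff2 n : R := ln (rootH n) - 2 * ln (rootH n.+1) + ln (rootH n.+2).

Definition ratioH n : R := (H n.+1)%:R / (H n)%:R.

(** The quadratic that satisfies the recurrence of [ratioH] up to O(1/x): comparing coefficients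
    forces 3/2 and then 3/4. *)
Definition ratio_approx x : R := x ^+ 2 + 3 / 2 * x + 3 / 4.

Lemma natr_H_gt0 n : (2 <= n)%N -> 0 < (H n)%:R :> R.
Proof. by case: n => [|[|n]] // _; rewrite ltr0n H_gt0. Qed.

Lemma ratioH_gt0 n : (2 <= n)%N -> 0 < ratioH n.
Proof. by move=> n2; rewrite divr_gt0 ?natr_H_gt0 // ltnW. Qed.

Lemma ratioH_recurrence n : (2 <= n)%N ->
  ratioH n.+1 = (n%:R + 1) * (n%:R + 2) * (1 + (n%:R + 1) / (2 * ratioH n)).
Proof.
move=> n2; have h0 := lt0r_neq0 (natr_H_gt0 n2).
have h1 := lt0r_neq0 (natr_H_gt0 (ltnW n2 : (2 <= n.+1)%N)).
have e : 2 * (H n.+2)%:R =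
    (n%:R + 1) * (n%:R + 2) * (2 * (H n.+1)%:R + (n%:R + 1) * (H n)%:R) :> R.
  have b : ('C(n.+2, 2) * 2 = n.+2 * n.+1)%N.
    by rewrite (bin_ffact n.+2 2) !ffactnS ffactn0 muln1.
  have bR : 2 * 'C(n.+2, 2)%:R = (n%:R + 1) * (n%:R + 2) :> R.
    by rewrite mulrC -natrM b natrM -!natr1; ring.
  rewrite H_recurrence natrM mulrA bR natrD !natrM -?natr1; ring.
have -> : ratioH n.+1 = 2 * (H n.+2)%:R / (2 * (H n.+1)%:R).
  by rewrite /ratioH; field; rewrite h1.
by rewrite e /ratioH; field; rewrite h0 h1.
Qed.

Lemma ratioH_bounds n : (6 <= n)%N ->
  ratio_approx n%:R <= ratioH n <= ratio_approx n%:R + 1 / 20.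
Proof.
elim: n => // n IH; rewrite leq_eqVlt => /predU1P[<-|n6].
  have /andP[/(natN_le R) lo /(natN_le R) up] := ratio_check.
  rewrite !(natNM _ (N.of_nat _) (HN _)) !natN_of !HNE in lo up.
  have h6 := natr_H_gt0 (isT : 2 <= 6)%N.
  rewrite /ratioH /ratio_approx ler_pdivlMr // ler_pdivrMr //; apply/andP; split; lra.
have /andP[lo up] := IH n6.
have x6 : 6 <= n%:R :> R by rewrite ler_nat.
have q0 : 0 < ratioH n by rewrite ratioH_gt0 //; lia.
rewrite ratioH_recurrence; last lia.
rewrite -natr1; move: (n%:R) (ratioH n) x6 q0 lo up; rewrite /ratio_approx.
move=> x y x6 y0 lo up.
have -> : (x + 1) * (x + 2) * (1 + (x + 1) / (2 * y)) =
    (x + 1) * (x + 2) + (x + 1) ^+ 2 * (x + 2) / (2 * y) by field; lra.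
(* The right-hand side decreases in y, so the upper bound of y gives the next lower bound and
   conversely. *)
apply/andP; split.
  rewrite -lerBlDl ler_pdivlMr; last lra.
  nra.
rewrite -lerBrDl ler_pdivrMr; last lra.
nra.
Qed.

Definition lnratio_diff2 n : R := ln (ratioH n.+2) - 2 * ln (ratioH n.+1) + ln (ratioH n).

(** The limit is -2, as q_n grows like n^2. With g = q_(n+2) q_n / q_(n+1)^2, the estimates 1 - 1/g
    <= ln g <= g - 1 and the bounds on q reduce both sides to polynomial inequalities. *)
Lemma lnratio_diff2_bounds n : (7 <= n)%N ->
  - (22 / 10) <= (n%:R + 1) * (n%:R + 2) * lnratio_diff2 n <= - (175 / 100).
Proof.
move=> n7.
have x7 : 7 <= n%:R :> R by rewrite ler_nat.
have q0 : 0 < ratioH n by rewrite ratioH_gt0 //; lia.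
have q1 : 0 < ratioH n.+1 by rewrite ratioH_gt0 //; lia.
have q2 : 0 < ratioH n.+2 by rewrite ratioH_gt0 //; lia.
have /andP[l0 u0] : ratio_approx n%:R <= ratioH n <= ratio_approx n%:R + 1 / 20.
  by apply: ratioH_bounds; lia.
have /andP[l1 u1] : ratio_approx n.+1%:R <= ratioH n.+1 <= ratio_approx n.+1%:R + 1 / 20.
  by apply: ratioH_bounds; lia.
have /andP[l2 u2] : ratio_approx n.+2%:R <= ratioH n.+2 <= ratio_approx n.+2%:R + 1 / 20.
  by apply: ratioH_bounds; lia.
have q20 : 0 < ratioH n.+2 * ratioH n by apply: mulr_gt0.
have q11 : 0 < ratioH n.+1 ^+ 2 by apply: exprn_gt0.
have d2E : lnratio_diff2 n = ln (ratioH n.+2 * ratioH n / ratioH n.+1 ^+ 2).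
  rewrite (ln_div q20 q11) (lnM q2 q0) (lnXn _ q1) /= /lnratio_diff2; ring.
have g0 : 0 < ratioH n.+2 * ratioH n / ratioH n.+1 ^+ 2 by apply: divr_gt0.
have lo := ln_ge_subV g0; have up := ln_le_subr1 g0.
rewrite -d2E in lo up; rewrite invf_div in lo.
have e1 : n.+1%:R = n%:R + 1 :> R by rewrite natr1.
have e2 : n.+2%:R = n%:R + 1 + 1 :> R by rewrite !natr1.
rewrite e1 in l1 u1; rewrite e2 in l2 u2.
move: (n%:R) (ratioH n) (ratioH n.+1) (ratioH n.+2) (lnratio_diff2 n)
  x7 q0 q1 q2 l0 u0 l1 u1 l2 u2 lo up {d2E g0 q20 q11 e1 e2}.
move=> x y0 y1 y2 d x7 q0 q1 q2 l0 u0 l1 u1 l2 u2 lo up.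
(* Written in t = x - 7, the difference of the two sides of each final inequality has degree 4 and
   positive coefficients. *)
have [t t0 xE] : exists2 t, 0 <= t & x = t + 7 by exists (x - 7); lra.
have t2 : 0 <= t ^+ 2 by rewrite exprn_ge0.
have t3 : 0 <= t ^+ 3 by rewrite exprn_ge0.
have t4 : 0 <= t ^+ 4 by rewrite exprn_ge0.
have [P PE] : exists P, P = (x + 1) * (x + 2) by eexists.
rewrite -PE; have P0 : 72 <= P by rewrite PE; nra.
have y11 : 0 < y1 ^+ 2 by rewrite exprn_gt0.
have y20 : 0 < y2 * y0 by rewrite mulr_gt0.
have z0 : 0 <= ratio_approx x by rewrite /ratio_approx; nra.
have z1 : 0 <= ratio_approx (x + 1) by rewrite /ratio_approx; nra.
have z2 : 0 <= ratio_approx (x + 1 + 1) by rewrite /ratio_approx; nra.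
apply/andP; split.
  apply: (@le_trans _ _ (P * (1 - y1 ^+ 2 / (y2 * y0)))); last first.
    by rewrite ler_pM2l //; lra.
  have e : y1 ^+ 2 / (y2 * y0) * (y2 * y0) = y1 ^+ 2 by rewrite divfK ?lt0r_neq0.
  rewrite -(ler_pM2r y20) (_ : P * _ * _ = P * (y2 * y0) - P * y1 ^+ 2); last first.
    by rewrite mulrBr mulr1 mulrBl -(mulrA P _ (y2 * y0)) e.
  have Y1 := ler_wpM2l (ltW (lt_le_trans (ltr0n R 72) P0))
    (ler_pM (ltW q1) (ltW q1) u1 u1).
  have P2 : 0 <= P + 22 / 10 by lra.
  have Y2 := ler_wpM2l P2 (ler_pM z2 z0 l2 l0).
  suff : P * ((ratio_approx (x + 1) + 1 / 20) * (ratio_approx (x + 1) + 1 / 20)) <=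
    (P + 22 / 10) * (ratio_approx (x + 1 + 1) * ratio_approx x) by lra.
  rewrite PE /ratio_approx xE; lra.
apply: (@le_trans _ _ (P * (y2 * y0 / y1 ^+ 2 - 1))); first by rewrite ler_pM2l //; lra.
have e : y2 * y0 / y1 ^+ 2 * y1 ^+ 2 = y2 * y0 by rewrite divfK ?lt0r_neq0.
rewrite -(ler_pM2r y11) (_ : P * _ * _ = P * (y2 * y0) - P * y1 ^+ 2); last first.
  by rewrite mulrBr mulr1 mulrBl -(mulrA P _ (y1 ^+ 2)) e.
have Y1 := ler_wpM2l (ltW (lt_le_trans (ltr0n R 72) P0)) (ler_pM (ltW q2) (ltW q0) u2 u0).
have P2 : 0 <= P - 175 / 100 by lra.
have Y2 := ler_wpM2l P2 (ler_pM z1 z1 l1 l1).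
suff : P * ((ratio_approx (x + 1 + 1) + 1 / 20) * (ratio_approx x + 1 / 20)) <=
  (P - 175 / 100) * (ratio_approx (x + 1) * ratio_approx (x + 1)) by lra.
rewrite PE /ratio_approx xE; lra.
Qed.

(* The telescoping identity: the ln H_k enter n (n+1) (n+2) s_n in such a way that
   only second differences of ln (H_(k+1) / H_k) survive in its increment. *)
Lemma lnroot_diff2_step n : (2 <= n)%N ->
  n.+1%:R * (n.+2%:R * n.+3%:R * lnroot_diff2 n.+1) =
  n%:R * (n.+1%:R * n.+2%:R * lnroot_diff2 n) + (n%:R + 1) * (n%:R + 2) * lnratio_diff2 n.
Proof.
move=> n2; have lnA k : ln (rootH k) = ln (H k)%:R / k%:R.
  by rewrite /rootH /nthroot ln_powR mulrC.
have lnq k : (2 <= k)%N -> ln (ratioH k) = ln (H k.+1)%:R - ln (H k)%:R.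
  by move=> k2; rewrite ln_div // posrE natr_H_gt0 // ltnW.
rewrite /lnroot_diff2 /lnratio_diff2 !lnA !lnq ?(leq_trans n2) //; [|lia..].
rewrite -!natr1; have x2 : 2 <= n%:R :> R by rewrite ler_nat.
by field; repeat (apply/andP; split); apply: lt0r_neq0; lra.
Qed.

(** By ln g <= g - 1 and ln g >= 1 - 1/g for g = ac / b^2; the constants satisfy 72 (281/288 - 1) =
    -175/100 and 72 (1 - 742/720) = -22/10. *)
Lemma ln_diff2_bounds (a b c : R) : 0 < a -> 0 < b -> 0 < c ->
  288 * (a * c) <= 281 * (b * b) -> 720 * (b * b) <= 742 * (a * c) ->
  - (22 / 10) <= (7 + 1) * (7 + 2) * (ln a - 2 * ln b + ln c) <= - (175 / 100).
Proof.
move=> a0 b0 c0 up lo.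
have ac0 : 0 < a * c by apply: mulr_gt0.
have bb0 : 0 < b * b by apply: mulr_gt0.
have -> : ln a - 2 * ln b + ln c = ln (a * c / (b * b)).
  by rewrite (ln_div ac0 bb0) (lnM a0 c0) (lnM b0 b0) /=; ring.
have g0 : 0 < a * c / (b * b) by apply: divr_gt0.
have := ln_ge_subV g0; have := ln_le_subr1 g0; rewrite invf_div.
have : a * c / (b * b) <= 281 / 288 by rewrite ler_pdivrMr //; lra.
have : b * b / (a * c) <= 742 / 720 by rewrite ler_pdivrMr //; lra.
by move=> *; apply/andP; split; lra.
Qed.

Lemma lnroot_diff2_bounds7 :
  - (22 / 10) <= (7 + 1) * (7 + 2) * lnroot_diff2 7 <= - (175 / 100).
Proof.
have /andP[/(natN_le R) c1 /(natN_le R) c2] := base_check.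
rewrite !natNM !natN_of in c1 c2.
have k := natN_ge0 R.
have [a7 a8 a9] : [/\ 0 < rootH 7, 0 < rootH 8 & 0 < rootH 9] by split; apply: rootH_gt0.
have /andP[l7 u7] := root_bounds (isT : 1 <= 7 <= 11)%N.
have /andP[l8 u8] := root_bounds (isT : 1 <= 8 <= 11)%N.
have /andP[l9 u9] := root_bounds (isT : 1 <= 9 <= 11)%N.
have l88 := ler_pM (k _) (k _) l8 l8; have l79 := ler_pM (k _) (k _) l7 l9.
rewrite /lnroot_diff2; move: c1 c2 a7 a8 a9 u7 u8 u9 l88 l79; clear.
move: (natN R _) (natN R _) (natN R _) (natN R _) (natN R _) (natN R _).
move: (rootH 7) (rootH 8) (rootH 9) => a b c n1 n2 n3 n4 n5 n6.
move=> c1 c2 a0 b0 c0 ua ub uc lb lac.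
have pa : 0 <= 1000 * a by rewrite mulr_ge0 // ltW.
have pb : 0 <= 1000 * b by rewrite mulr_ge0 // ltW.
have pc : 0 <= 1000 * c by rewrite mulr_ge0 // ltW.
have uac := ler_pM pa pc ua uc; have ubb := ler_pM pb pb ub ub.
by apply: ln_diff2_bounds => //; lra.
Qed.

(** By the telescoping step, the quantity at n+1 is the average of the one at n, with weight n, and
    of its analogue for [lnratio_diff2], with weight 1. Both lie in the same interval. *)
Lemma lnroot_diff2_bounds n : (7 <= n)%N ->
  - (22 / 10) <= (n%:R + 1) * (n%:R + 2) * lnroot_diff2 n <= - (175 / 100).
Proof.
elim: n => // n IH; rewrite leq_eqVlt => /predU1P[<-|n7].
  exact: lnroot_diff2_bounds7.
have := lnroot_diff2_step (leq_trans (isT : (2 <= 7)%N) n7).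
have := IH n7; have := lnratio_diff2_bounds n7.
have : 7 <= n%:R :> R by rewrite ler_nat.
have e3 : n.+3%:R = n%:R + 3 :> R by rewrite -addn3 natrD.
have e2 : n.+2%:R = n%:R + 2 :> R by rewrite -addn2 natrD.
have e1 : n.+1%:R = n%:R + 1 :> R by rewrite natr1.
rewrite e3 e2 e1; move: (n%:R) (lnratio_diff2 n) (lnroot_diff2 n) (lnroot_diff2 n.+1).
move=> x d t t' x7.
have -> : x + 1 + 1 = x + 2 by ring.
have -> : x + 1 + 2 = x + 3 by ring.
move: (_ * _ * d) (_ * _ * t) (_ * _ * t') => D S S' /andP[d1 d2] /andP[s1 s2] e.
have x1 : 0 < x + 1 by lra.
by apply/andP; split; rewrite -(ler_pM2l x1) e; nra.
Qed.

Lemma lnroot_diff2_addn_bounds n k : (7 <= n)%N ->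
  - (22 / 10) <= (n%:R + k.+1%:R) * (n%:R + k.+2%:R) * lnroot_diff2 (n + k)
    <= - (175 / 100) /\ lnroot_diff2 (n + k) < 0.
Proof.
move=> n7; have := lnroot_diff2_bounds (leq_trans n7 (leq_addr k n)).
rewrite natrD -[k.+2]addn2 -[k.+1]addn1 !natrD !addrA.
have : 0 <= n%:R + k%:R :> R by rewrite addr_ge0.
move: (n%:R + k%:R) (lnroot_diff2 _) => x y x0 b; split=> //.
have [_ up] := andP b.
rewrite -(pmulr_rlt0 _ (_ : 0 < (x + 1) * (x + 2))); first lra.
by apply: mulr_gt0; lra.
Qed.

(** * The cases n >= 7 *)

Lemma ler_mul_shrink (a b t y : R) : a <= b -> y <= 0 -> t <= b * y -> t <= a * y.
Proof. by move=> ab y0 /le_trans; apply; rewrite ler_wnM2r. Qed.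

Lemma laguerre_ineq1 (x s0 s1 s2 : R) : 7 <= x ->
  - (22 / 10) <= (x + 1) * (x + 2) * s0 ->
  - (22 / 10) <= (x + 2) * (x + 3) * s1 <= - (175 / 100) -> s1 < 0 ->
  - (22 / 10) <= (x + 3) * (x + 4) * s2 -> s2 < 0 ->
  4 * (x + 2) * (x + 4) <=
  (1 - s1) * ((x + 1) * (x + 2) * (1 + (s0 + 2 * s1 + s2)) + 3 * (x + 3) * (x + 4)).
Proof.
move=> x7 l0 /andP[l1 u1] n1 l2 n2.
have m1 : - (22 / 10) <= (x + 1) * (x + 2) * s1.
  by apply: ler_mul_shrink l1; [nra | exact: ltW].
have m2 : - (22 / 10) <= (x + 1) * (x + 2) * s2.
  by apply: ler_mul_shrink l2; [nra | exact: ltW].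
(* 292/10 = 2 + 36 - 4 * 22/10. It falls short of the constant 32 on the left by 28/10; the factor 1
   - s1 makes up for this, since its gain tends to 4 * 175/100 = 7. *)
have E : 4 * x ^+ 2 + 24 * x + 292 / 10 <=
  (x + 1) * (x + 2) * (1 + (s0 + 2 * s1 + s2)) + 3 * (x + 3) * (x + 4) by lra.
apply: (@le_trans _ _ ((1 - s1) * (4 * x ^+ 2 + 24 * x + 292 / 10))); last first.
  by rewrite ler_pM2l //; lra.
have Q : 0 < (x + 2) * (x + 3) by apply: mulr_gt0; lra.
have w : (x + 2) * (x + 3) + 175 / 100 <= (x + 2) * (x + 3) * (1 - s1) by lra.
have F : 0 <= 4 * x ^+ 2 + 24 * x + 292 / 10 by nra.
rewrite -(ler_pM2l Q) [leRHS]mulrA; apply: le_trans (ler_wpM2r F w).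
clear -x7; nra.
Qed.

Lemma laguerre_ineq2 (x s0 s1 s2 s3 : R) : 7 <= x ->
  (x + 1) * (x + 2) * s0 <= - (175 / 100) -> s0 < 0 ->
  - (22 / 10) <= (x + 2) * (x + 3) * s1 <= - (175 / 100) -> s1 < 0 ->
  - (22 / 10) <= (x + 3) * (x + 4) * s2 <= - (175 / 100) -> s2 < 0 ->
  - (22 / 10) <= (x + 4) * (x + 5) * s3 -> s3 < 0 ->
  s2 - s1 < 1 /\
  4 * (x + 2) * (x + 4) <= (1 - (s2 - s1)) *
    ((x + 1) * (x + 2) * (1 + (s3 + s2 - s1 - s0)) + 3 * (x + 3) * (x + 4)).
Proof.
move=> x7 u0 n0 /andP[l1 u1] n1 /andP[l2 u2] n2 l3 n3.
have Q : 0 < (x + 2) * (x + 3) by apply: mulr_gt0; lra.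
(* The bound is 22/10 - 175/100 (x+2)/(x+4), which decreases in x and is just below 77/100 at x =
   7. *)
have U : (x + 2) * (x + 3) * (s2 - s1) <= 77 / 100.
  have P : 0 < x + 4 by lra.
  rewrite -(ler_pM2r P); clear -x7 l1 u2 n2 Q P.
  nra.
have m0 : (x + 3) * (x + 4) * s0 <= - (175 / 100).
  by apply: le_trans u0; rewrite ler_wnM2r ?ltW //; nra.
have m1 : (x + 3) * (x + 4) * s1 <= - (175 / 100).
  by apply: le_trans u1; rewrite ler_wnM2r ?ltW //; nra.
have m3 : - (22 / 10) <= (x + 3) * (x + 4) * s3.
  by apply: ler_mul_shrink l3; [nra | exact: ltW].
(* -9/10 = 2 * 175/100 - 2 * 22/10 holds for the factor (x+3)(x+4); passing to the smaller factor is
   sound when the sum is negative, hence the case split. *)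
have V : - (9 / 10) <= (x + 1) * (x + 2) * (s3 + s2 - s1 - s0).
  have [v0|v0] := lerP 0 (s3 + s2 - s1 - s0).
    by apply: (@le_trans _ _ 0); [lra | rewrite !mulr_ge0 //; lra].
  by apply: (@ler_mul_shrink _ ((x + 3) * (x + 4))); [nra | exact: ltW | lra].
move: (s2 - s1) (s3 + s2 - s1 - s0) U V => u v U V.
clear -x7 Q U V.
(* 371/10 = 2 + 36 - 9/10 exceeds 32 by 51/10, more than the loss caused by the factor 1 - u, which
   tends to at most 4 * 77/100. *)
have E : 4 * x ^+ 2 + 24 * x + 371 / 10 <=
  (x + 1) * (x + 2) * (1 + v) + 3 * (x + 3) * (x + 4) by lra.
have u1 : 0 < 1 - u by rewrite -(pmulr_rgt0 _ Q); nra.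
split; first lra.
apply: (@le_trans _ _ ((1 - u) * (4 * x ^+ 2 + 24 * x + 371 / 10))); last first.
  by rewrite ler_pM2l.
have w : (x + 2) * (x + 3) - 77 / 100 <= (x + 2) * (x + 3) * (1 - u) by lra.
have F : 0 <= 4 * x ^+ 2 + 24 * x + 371 / 10 by nra.
rewrite -(ler_pM2l Q) [leRHS]mulrA; apply: le_trans (ler_wpM2r F w).
clear -x7; nra.
Qed.

Lemma laguerre_large1 n : (7 <= n)%N ->
  0 <= L2 (fun n => rootH n / n`!%:R) n.
Proof.
move=> n7; have x7 : 7 <= n%:R :> R by rewrite ler_nat.
have [/andP[l0 _] _] := lnroot_diff2_addn_bounds 0 n7.
have [b1 n1] := lnroot_diff2_addn_bounds 1 n7.
have [/andP[l2 _] n2] := lnroot_diff2_addn_bounds 2 n7.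
rewrite addn0 in l0.
(* A second difference of step 2 is the sum of those of step 1 with weights 1, 2, 1. *)
apply: (L2_div_fact_ge0_ln (b := rootH) (u := lnroot_diff2 (n + 1))
  (v := lnroot_diff2 n + 2 * lnroot_diff2 (n + 1) + lnroot_diff2 (n + 2))) => //.
- by move=> k nk; apply: rootH_gt0; clear -n7 nk; lia.
- by clear; rewrite /lnroot_diff2 !addnS !addn0; ring.
- by clear; rewrite /lnroot_diff2 !addnS !addn0; ring.
- exact: lt_trans n1 ltr01.
exact: laguerre_ineq1.
Qed.

Lemma laguerre_large2 n : (7 <= n)%N ->
  0 <= L2 (fun n => rootH n.+1 / rootH n / n`!%:R) n.
Proof.
move=> n7; have x7 : 7 <= n%:R :> R by rewrite ler_nat.
have [/andP[_ u0] n0] := lnroot_diff2_addn_bounds 0 n7.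
have [b1 n1] := lnroot_diff2_addn_bounds 1 n7.
have [b2 n2] := lnroot_diff2_addn_bounds 2 n7.
have [/andP[l3 _] n3] := lnroot_diff2_addn_bounds 3 n7.
rewrite addn0 in u0 n0.
have [u1 ineq] := laguerre_ineq2 x7 u0 n0 b1 n1 b2 n2 l3 n3.
have pos k : (n <= k)%N -> 0 < rootH k.
  by move=> nk; apply: rootH_gt0; clear -n7 nk; lia.
have lnE k : (n <= k)%N -> ln (rootH k.+1 / rootH k) = ln (rootH k.+1) - ln (rootH k).
  by move=> nk; rewrite ln_div // posrE pos // ltnW.
(* For quotients, u and v are the differences between the previous case's expressions at n+1 and at
   n. *)
apply: (L2_div_fact_ge0_ln (b := fun k => rootH k.+1 / rootH k)
  (u := lnroot_diff2 (n + 2) - lnroot_diff2 (n + 1)) (v := lnroot_diff2 (n + 3) +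
     lnroot_diff2 (n + 2) - lnroot_diff2 (n + 1) - lnroot_diff2 n)) => //.
- by move=> k nk; apply: divr_gt0; apply: pos => //; exact: ltnW.
- rewrite !lnE ?leq_addr //; clear; rewrite /lnroot_diff2 !addnS !addn0; ring.
- rewrite !lnE ?leq_addr //; clear; rewrite /lnroot_diff2 !addnS !addn0; ring.
Qed.

End Real.

Theorem theorem3p4 (R : realType) :
  laguerre_order2 1 (fun n : nat => nthroot n (H n)%:R / n`!%:R : R)
  /\ laguerre_order2 2 (fun n : nat =>
       nthroot n.+1 (H n.+1)%:R / (nthroot n (H n)%:R * n`!%:R) : R).
Proof.
split=> n n1.
  have [n6|n7] := leqP n 6; [apply: laguerre_small1 | exact: laguerre_large1].
  by rewrite n1.
rewrite (_ : (fun _ => _) = (fun n => rootH R n.+1 / rootH R n / n`!%:R)).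
  have [n6|n7] := leqP n 6; [apply: laguerre_small2 | exact: laguerre_large2].
  by rewrite n1.
by apply/boolp.funext => k; rewrite invfM mulrA.
Qed.
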